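(* Let $\mathcal{L}_1=(S_1,\iota_1,\rightarrow_1)$ and $\mathcal{L}_2=(S_2,\iota_2,\rightarrow_2)$ be two LTSs with finitely many states. Then: (i) $\textsc{Refines}_{\mathsf{tr}}(\mathcal{L}_1,\mathcal{L}_2)$ returns true if and only if $\mathcal{L}_1\sqsubseteq_{\mathsf{tr}}\mathcal{L}_2$; (ii) $\textsc{Refines}_{\mathsf{sfr}}(\mathcal{L}_1,\mathcal{L}_2)$ returns true if and only if $\mathcal{L}_1\sqsubseteq_{\mathsf{sfr}}\mathcal{L}_2$; (iii) $\textsc{Refines}_{\mathsf{fdr}}(\mathcal{L}_1,\mathcal{L}_2)$ returns true if and only if $\mathcal{L}_1\sqsubseteq_{\mathsf{fdr}}\mathcal{L}_2$.
   Context: Fix a finite set $\mathit{Act}$ of actions not containing the internal action $\tau$; $\mathit{Act}_\tau=\mathit{Act}\cup\{\tau\}$. An LTS is $(S,\iota,\rightarrow)$ with $\iota\in S$ and $\rightarrow\subseteq S\times\mathit{Act}_\tau\times S$; $\mathsf{enabled}(s)=\{a\in\mathit{Act}_\tau\mid\exists t: s\xrightarrow{a}t\}$. The weak transition relation $\Longrightarrow\subseteq S\times\mathit{Act}^*\times S$ is the smallest relation with $s\overset{\epsilon}{\Longrightarrow}s$; $s\overset{\epsilon}{\Longrightarrow}t$ if $s\xrightarrow{\tau}t$; $s\overset{a}{\Longrightarrow}t$ if $s\xrightarrow{a}t$ ($a\in\mathit{Act}$); $s\overset{\rho\sigma}{\Longrightarrow}t$ if $s\overset{\rho}{\Longrightarrow}u\overset{\sigma}{\Longrightarrow}t$.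 $\mathsf{weaktraces}(\mathcal{L})=\{\rho\in\mathit{Act}^*\mid\exists t:\iota\overset{\rho}{\Longrightarrow}t\}$. A state $s$ is stable if $\tau\notin\mathsf{enabled}(s)$; for stable $s$, $\mathsf{refusals}(s)=\mathcal{P}(\mathit{Act}\setminus\mathsf{enabled}(s))$; for a set $U$ of states, $\mathsf{refusals}(U)=\{X\subseteq\mathit{Act}\mid\exists s\in U: s\text{ stable}\wedge X\in\mathsf{refusals}(s)\}$. A state $s$ diverges if there is an infinite sequence $s\xrightarrow{\tau}s_1\xrightarrow{\tau}s_2\xrightarrow{\tau}\cdots$; a set diverges if one of its states does. $\mathsf{divergences}(\mathcal{L})=\{\rho\sigma\in\mathit{Act}^*\mid\exists t:\iota\overset{\rho}{\Longrightarrow}t\wedge t\text{ diverges}\}$; $\mathsf{failures}(\mathcal{L})=\{(\rho,X)\in\mathit{Act}^*\times\mathcal{P}(\mathit{Act})\mid\exists t:\iota\overset{\rho}{\Longrightarrow}t,\ t\text{ stable},\ X\in\mathsf{refusals}(t)\}$; $\mathsf{failures}_\bot(\mathcal{L})=\mathsf{failures}(\mathcal{L})\cup\{(\rho,X)\mid\rho\in\mathsf{divergences}(\mathcal{L}),X\subseteq\mathit{Act}\}$. Refinements: $\mathcal{L}_1\sqsubseteq_{\mathsf{tr}}\mathcal{L}_2$ iff $\mathsf{weaktraces}(\mathcal{L}_2)\subseteq\mathsf{weaktraces}(\mathcal{L}_1)$; $\mathcal{L}_1\sqsubseteq_{\mathsf{sfr}}\mathcal{L}_2$ iff $\mathsf{failures}(\mathcal{L}_2)\subseteq\mathsf{failures}(\mathcal{L}_1)$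 and $\mathsf{weaktraces}(\mathcal{L}_2)\subseteq\mathsf{weaktraces}(\mathcal{L}_1)$; $\mathcal{L}_1\sqsubseteq_{\mathsf{fdr}}\mathcal{L}_2$ iff $\mathsf{failures}_\bot(\mathcal{L}_2)\subseteq\mathsf{failures}_\bot(\mathcal{L}_1)$ and $\mathsf{divergences}(\mathcal{L}_2)\subseteq\mathsf{divergences}(\mathcal{L}_1)$. Antichain notation on pairs $(U,s)\in\mathcal{P}(S_1)\times S_2$: order $(U,s)\leq(V,t)$ iff $s=t$ and $U\subseteq V$; for a set $\mathcal{A}$ of pairs, $x\Subset\mathcal{A}$ iff some $y\in\mathcal{A}$ has $y\leq x$; $\mathcal{A}\Cup x=\{z\mid z=x\vee(z\in\mathcal{A}\wedge x\not\leq z)\}$. The algorithms: let $I=(\{s\in S_1\mid\iota_1\overset{\epsilon}{\Longrightarrow}_1s\},\iota_2)$. Initialise a stack $\mathit{working}$ containing only $I$ and $\mathit{antichain}:=\{I\}$. While $\mathit{working}$ is nonempty: pop $(\mathit{spec},\mathit{impl})$ from $\mathit{working}$; perform the variant-specific checks (below); then, unless skipped, for each transition $\mathit{impl}\xrightarrow{a}_2\mathit{impl}'$: let $\mathit{spec}'=\mathit{spec}$ if $a=\tau$ and $\mathit{spec}'=\{s'\in S_1\mid\exists s\in\mathit{spec}: s\overset{a}{\Longrightarrow}_1s'\}$ otherwise; if $\mathit{spec}'=\emptyset$ return false; if $(\mathit{spec}',\mathit{impl}')\not\Subset\mathit{antichain}$ then set $\mathit{antichain}:=\mathit{antichain}\Cup(\mathit{spec}',\mathit{impl}')$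 and push $(\mathit{spec}',\mathit{impl}')$ onto $\mathit{working}$. When $\mathit{working}$ becomes empty, return true. Variant checks: $\textsc{Refines}_{\mathsf{tr}}$ performs no checks. $\textsc{Refines}_{\mathsf{sfr}}$: if $\mathit{impl}$ is stable and $\mathsf{refusals}(\mathit{impl})\not\subseteq\mathsf{refusals}(\mathit{spec})$, return false. $\textsc{Refines}_{\mathsf{fdr}}$: if $\mathit{spec}$ diverges, skip the for-loop for this pair (continue with the next iteration); otherwise, if $\mathit{impl}$ diverges return false, and if $\mathit{impl}$ is stable and $\mathsf{refusals}(\mathit{impl})\not\subseteq\mathsf{refusals}(\mathit{spec})$ return false, then execute the for-loop. *)

(* Defs.v *)
From mathcomp Require Import all_boot.
From mathcomp Require Import boolp classical_sets.

Set Implicit Arguments.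
Unset Strict Implicit.
Unset Printing Implicit Defensive.

(* Act_tau is [option Act], with [None] the internal action tau. *)
Record lts (Act : finType) := LTS {
  state : finType;
  init : state;
  trans : state -> option Act -> state -> bool
}.

Section Semantics.
Variables (Act : finType) (L : lts Act).
Implicit Types (s t u : state L) (rho sigma : seq Act) (X : {set Act}).

Definition enabled s : {set option Act} :=
  [set a | [exists t, trans s a t]]%SET.

Inductive weak : state L -> seq Act -> state L -> Prop :=
| weak_refl s : weak s [::] s
| weak_tau s t : trans s None t -> weak s [::] t
| weak_act s a t : trans s (Some a) t -> weak s [:: a] t
| weak_cat s rho u sigma t :
    weak s rho u -> weak u sigma t -> weak s (rho ++ sigma) t.

Definition weaktraces : set (seq Act) :=
  [set rho | exists t, weak (init L) rho t]%classic.

Definition stable s : bool := None \notin enabled s.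

(* Only meaningful, and only used, for stable s. *)
Definition refusals s : {set {set Act}} :=
  powerset [set a : Act | Some a \notin enabled s]%SET.

Definition set_refusals (U : {set state L}) : {set {set Act}} :=
  [set X : {set Act} | [exists s in U, stable s && (X \in refusals s)]]%SET.

Definition diverges s : Prop :=
  exists f : nat -> state L, f 0 = s /\ forall n, trans (f n) None (f n.+1).

Definition set_diverges (U : {set state L}) : Prop :=
  exists2 s, s \in U & diverges s.

Definition divergences : set (seq Act) :=
  [set w | exists rho sigma, w = rho ++ sigma /\
     exists t, weak (init L) rho t /\ diverges t]%classic.

Definition failures : set (seq Act * {set Act}) :=
  [set f | exists t,
     [/\ weak (init L) f.1 t, stable t & f.2 \in refusals t]]%classic.

Definition failures_bot : set (seq Act * {set Act}) :=
  (failures `|` [set f | divergences f.1])%classic.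

End Semantics.

Section Refinement.
Variables (Act : finType) (L1 L2 : lts Act).

Definition refines_tr : Prop := (weaktraces L2 `<=` weaktraces L1)%classic.

Definition refines_sfr : Prop :=
  (failures L2 `<=` failures L1)%classic /\
  (weaktraces L2 `<=` weaktraces L1)%classic.

Definition refines_fdr : Prop :=
  (failures_bot L2 `<=` failures_bot L1)%classic /\
  (divergences L2 `<=` divergences L1)%classic.

End Refinement.

Section Antichain.
Variables S1 S2 : finType.
Implicit Types (x y : {set S1} * S2) (A : {set {set S1} * S2}).

Definition pair_le x y : bool := (x.2 == y.2) && (x.1 \subset y.1).

Definition covered x A : bool := [exists y in A, pair_le y x].

Definition antichain_add A x : {set {set S1} * S2} :=
  [set z | (z == x) || (z \in A) && ~~ pair_le x z]%SET.

End Antichain.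

Inductive variant := Tr | Sfr | Fdr.

Inductive verdict := Reject | Skip | Proceed.

Section Algorithm.
Variables (Act : finType) (L1 L2 : lts Act).

Local Notation pair := ({set state L1} * state L2)%type.
Local Notation transitions := (seq (option Act * state L2)).

Definition init_pair : pair :=
  ([set s | `[< weak (init L1) [::] s >]]%SET, init L2).

Definition post (spec : {set state L1}) (a : option Act) : {set state L1} :=
  if a is Some b
  then [set s' | `[< exists2 s, s \in spec & weak s [:: b] s' >]]%SET
  else spec.

Definition refusals_ok (x : pair) : bool :=
  stable x.2 ==> (refusals x.2 \subset set_refusals x.1).

Definition check (v : variant) (x : pair) : verdict :=
  match v with
  | Tr => Proceed
  | Sfr => if refusals_ok x then Proceed else Reject
  | Fdr => if `[< set_diverges x.1 >] then Skip
           else if `[< diverges x.2 >] then Reject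
           else if refusals_ok x then Proceed else Reject
  end.

(* [Running working antichain]: the top of the stack is the head of the list. *)
Inductive config :=
| Running of seq pair & {set pair}
| Returned of bool.

Fixpoint for_loop (spec : {set state L1}) (ts : transitions)
    (working : seq pair) (antichain : {set pair}) : config :=
  if ts is (a, impl') :: ts' then
    let spec' := post spec a in
    if spec' == finset.set0 then Returned false
    else if covered (spec', impl') antichain
    then for_loop spec ts' working antichain
    else for_loop spec ts' ((spec', impl') :: working)
           (antichain_add antichain (spec', impl'))
  else Running working antichain.

(* One iteration of the while loop; [ord s] lists the outgoing transitions of s
   in the order in which the for-loop visits them. *)
Definition step (v : variant) (ord : state L2 -> transitions) (c : config) :
    config :=
  match c with
  | Running [::] _ => Returned true
  | Running (x :: working) antichain =>
      match check v x with
      | Reject => Returned false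
      | Skip => Running working antichain
      | Proceed => for_loop x.1 (ord x.2) working antichain
      end
  | Returned b => Returned b
  end.

(* The algorithm leaves the order of the for-loop open. A schedule fixes it,
   possibly differently in each iteration n of the while loop, so that every
   execution of the algorithm is the run of some schedule. *)
Definition is_schedule (sched : nat -> state L2 -> transitions) : Prop :=
  forall n s, perm_eq (sched n s)
    (enum [set p : option Act * state L2 | trans s p.1 p.2]%SET).

Fixpoint run (v : variant) (sched : nat -> state L2 -> transitions) (n : nat) :
    config :=
  if n is m.+1 then step v (sched m) (run v sched m)
  else Running [:: init_pair] [set init_pair]%SET.

Definition returns (v : variant) (sched : nat -> state L2 -> transitions)
    (b : bool) : Prop :=
  exists n, run v sched n = Returned b.

End Algorithm.

(* Main.v *)
Require Import Defs.
From mathcomp Require Import boolp.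
From mathcomp Require Import all_boot.

(** Write [after rho] for the set of L1-states weakly reachable by [rho]; it is
    obtained by iterating [post].  Every check of the algorithm is monotone: if
    [y <= x] and [y] passes, then [x] passes or, for [Fdr], is skipped.  If the
    algorithm returns true, the final antichain is closed under successors up to
    [<=], so it covers [(after rho, t)] for every L2-path labelled [rho] to [t],
    unless [rho] is a divergence of L1 in the [Fdr] case; refinement follows.
    Conversely, under refinement no visited pair is rejected, and the loop ends
    because a pair is pushed only when it is not covered yet, and it then stays
    covered forever: [2 * #uncovered pairs + size of the stack] decreases. *)

Set Implicit Arguments.
Unset Strict Implicit.
Unset Printing Implicit Defensive.

(** * Weak transitions, divergences and failures of a single LTS *)

Section Weak.
Variables (Act : finType) (L : lts Act).
Implicit Types (s t u : state L) (rho : seq Act).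

(** [weak] composes at arbitrary points. This form grows one transition at a time at the end, so
    that induction follows a run and can be inverted at its last letter. *)
Inductive path_to s : seq Act -> state L -> Prop :=
| path_refl : path_to s [::] s
| path_tau rho u t : path_to s rho u -> trans u None t -> path_to s rho t
| path_act rho u a t :
    path_to s rho u -> trans u (Some a) t -> path_to s (rcons rho a) t.

Lemma path_to_cat s rho u sigma t :
  path_to s rho u -> path_to u sigma t -> path_to s (rho ++ sigma) t.
Proof.
move=> su; elim=> [|sig v w _ IH vw|sig v a w _ IH vw]; first by rewrite cats0.
- exact: path_tau IH vw.
- by rewrite -rcons_cat; exact: path_act IH vw.
Qed.

Lemma weakP s rho t : weak s rho t <-> path_to s rho t.
Proof.
split.
  elim=> {s rho t} [s|s t st|s a t st|s rho u sigma t _ IH1 _ IH2].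
  - exact: path_refl.
  - exact: path_tau (path_refl s) st.
  - exact: path_act (path_refl s) st.
  - exact: path_to_cat IH1 IH2.
elim=> [|sig v w _ IH vw|sig v a w _ IH vw]; first exact: weak_refl.
- by rewrite -[sig]cats0; exact: weak_cat IH (weak_tau vw).
- by rewrite -cats1; exact: weak_cat IH (weak_act vw).
Qed.

Lemma weak_rcons s rho a t :
  weak s (rcons rho a) t <-> exists2 u, weak s rho u & weak u [:: a] t.
Proof.
split=> [/weakP|[u su ut]]; last by rewrite -cats1; exact: weak_cat su ut.
move eq_w: (rcons rho a) => w st.
elim: st eq_w => [|sig v x _ IH vx|sig v b x sv _ vx].
- by case: rho.
- move=> /IH[u su uv]; exists u => //.
  by rewrite -[[:: a]]cats0; exact: weak_cat uv (weak_tau vx).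
- move=> /rcons_inj[-> ->]; exists v; first exact/weakP.
  exact: weak_act.
Qed.

Definition after rho : {set state L} := [set s | `[< weak (init L) rho s >]].

Lemma in_after rho s : (s \in after rho) <-> weak (init L) rho s.
Proof. by rewrite inE; split=> /asboolP. Qed.

(** If no stable state is reachable by tau steps, every state so reachable has a tau successor, and
    iterating a choice of successors diverges. *)
Lemma tau_diverges_or_stable s :
  diverges s \/ exists2 t, weak s [::] t & stable t.
Proof.
have [stab|nstab] := pselect (exists2 t, weak s [::] t & stable t).
  by right.
(* The implication inside the sigma type makes [next] total: off the tau-reachable states any value
   will do. *)
left; have next t : {u | weak s [::] t -> trans t None u}.
  apply: cid; have [st|nst] := pselect (weak s [::] t); last by exists t.
  have : ~~ stable t by apply/negP => stab; apply: nstab; exists t.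
  by rewrite /stable negbK inE => /existsP[u tu]; exists u.
exists (fun n => iter n (fun t => sval (next t)) s); split=> // n /=.
case: (next _) => u /= tu; apply: tu.
elim: n => [|n IHn] /=; first exact: weak_refl.
case: (next _) => u' /= tu'.
by rewrite -[[::]]cats0; exact: weak_cat IHn (weak_tau (tu' IHn)).
Qed.

(** The diverging prefix is either proper, hence a prefix of [rho], or the whole word. *)
Lemma divergences_rcons rho a :
  divergences L (rcons rho a) <->
  divergences L rho \/ set_diverges (after (rcons rho a)).
Proof.
split=> [[r [sigma [eq_rho [t [rt dt]]]]]|[[r [sigma [-> dt]]]|[t /in_after rt dt]]].
- case/lastP: sigma eq_rho => [|sigma b].
    by rewrite cats0 => ->; right; exists t => //; apply/in_after.
  rewrite -rcons_cat => /rcons_inj[-> _]; left.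
  by exists r, sigma; split=> //; exists t.
- by exists r, (rcons sigma a); split; [rewrite rcons_cat | exact: dt].
- by exists (rcons rho a), [::]; rewrite cats0; split=> //; exists t.
Qed.

Lemma after_diverges rho : set_diverges (after rho) -> divergences L rho.
Proof.
case=> t /in_after rt dt.
by exists rho, [::]; rewrite cats0; split=> //; exists t.
Qed.

Lemma set_diverges_sub (U V : {set state L}) :
  U \subset V -> set_diverges U -> set_diverges V.
Proof. by move=> /subsetP UV [s /UV sV ds]; exists s. Qed.

Lemma set_refusals_sub (U V : {set state L}) :
  U \subset V -> set_refusals U \subset set_refusals V.
Proof.
move=> /subsetP UV; apply/subsetP=> X; rewrite !inE => /exists_inP[s /UV sV sX].
by apply/exists_inP; exists s.
Qed.

Lemma set_refusals_after rho (X : {set Act}) :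
  X \in set_refusals (after rho) <-> failures L (rho, X).
Proof.
rewrite inE; split=> [/exists_inP[s /in_after rs /andP[ss sX]]|[s [rs ss sX]]].
  by exists s.
by apply/exists_inP; exists s; [exact/in_after | rewrite ss].
Qed.

(** This recovers traces from failures-divergences refinement: a trace leads to a divergence or to a
    stable state, and the latter refuses the empty set. *)
Lemma weaktraces_failures_bot rho :
  weaktraces L rho -> failures_bot L (rho, set0).
Proof.
move=> [t rt]; have [dt|[u tu stu]] := tau_diverges_or_stable t.
  by right; exists rho, [::]; rewrite cats0; split=> //; exists t.
left; exists u; split=> //=; last by rewrite powersetE sub0set.
by rewrite -[rho]cats0; exact: weak_cat rt tu.
Qed.

End Weak.

(** * The order on pairs and coverage by an antichain *)

Section AntichainTheory.
Variables S1 S2 : finType.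
Implicit Types (x y z : {set S1} * S2) (A : {set {set S1} * S2}).

Lemma pair_le_refl x : pair_le x x.
Proof. by rewrite /pair_le eqxx subxx. Qed.

Lemma pair_le_trans y x z : pair_le x y -> pair_le y z -> pair_le x z.
Proof.
move=> /andP[/eqP xy sxy] /andP[/eqP yz syz].
by rewrite /pair_le xy yz eqxx (subset_trans sxy).
Qed.

Lemma covered_le x z A : covered x A -> pair_le x z -> covered z A.
Proof.
move=> /exists_inP[y yA yx] xz.
by apply/exists_inP; exists y => //; exact: pair_le_trans xz.
Qed.

Lemma covered_mem x A : x \in A -> covered x A.
Proof. by move=> xA; apply/exists_inP; exists x => //; exact: pair_le_refl. Qed.

Lemma covered_add_self A x : covered x (antichain_add A x).
Proof. by apply: covered_mem; rewrite inE eqxx. Qed.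

(** A pair removed from [A] lies above [x], so whatever it covered is now covered by [x]. *)
Lemma covered_add A x z : covered z A -> covered z (antichain_add A x).
Proof.
move=> /exists_inP[y yA yz]; have [xy|nxy] := boolP (pair_le x y).
  exact: covered_le (covered_add_self A x) (pair_le_trans xy yz).
by apply/exists_inP; exists y; rewrite // inE yA nxy orbT.
Qed.

Definition uncovered A := #|[set z | ~~ covered z A]|.

Lemma uncovered_add A x :
  ~~ covered x A -> uncovered (antichain_add A x) < uncovered A.
Proof.
move=> ncx; apply/proper_card/properP; split.
  by apply/subsetP=> z; rewrite !inE; apply: contra; exact: covered_add.
by exists x; rewrite !inE // covered_add_self.
Qed.

End AntichainTheory.

(** * Macro-steps of the specification and monotonicity of the checks *)

Section Correctness.
Variables (Act : finType) (L1 L2 : lts Act).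
Local Notation pair := ({set state L1} * state L2)%type.
Implicit Types (v : variant) (x y : pair) (A : {set pair}) (w : seq pair).

Lemma post_sub (U V : {set state L1}) a : U \subset V -> post U a \subset post V a.
Proof.
case: a => [a|] // /subsetP UV; apply/subsetP=> s.
by rewrite !inE => /asboolP[u /UV uV us]; apply/asboolP; exists u.
Qed.

Lemma post_after rho a : post (after L1 rho) (Some a) = after L1 (rcons rho a).
Proof.
apply/setP=> s; rewrite !inE; apply/asbool_equiv_eq; split.
  by case=> u /in_after ru us; apply/weak_rcons; exists u.
by move=> /weak_rcons[u ru us]; exists u => //; apply/in_after.
Qed.

Lemma after_neq0 rho : (after L1 rho != set0) <-> weaktraces L1 rho.
Proof.
split=> [/set0Pn[s /in_after rs]|[s rs]]; first by exists s.
by apply/set0Pn; exists s; apply/in_after.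
Qed.

Lemma refusals_ok_le x y : pair_le x y -> refusals_ok x -> refusals_ok y.
Proof.
move=> /andP[/eqP e2 s1]; rewrite /refusals_ok e2 => /implyP ok.
by apply/implyP=> /ok xs; exact: subset_trans xs (set_refusals_sub s1).
Qed.

Lemma refusals_ok_after rho t : weak (init L2) rho t ->
  (forall X, failures L2 (rho, X) -> failures L1 (rho, X)) ->
  refusals_ok (after L1 rho, t).
Proof.
move=> rt sub; apply/implyP=> st; apply/subsetP=> X tX.
by apply/set_refusals_after/sub; exists t.
Qed.

Lemma failures_refusals_ok rho (t : state L2) X :
  stable t -> X \in refusals t -> refusals_ok (after L1 rho, t) ->
  failures L1 (rho, X).
Proof.
move=> st tX /implyP/(_ st)/subsetP sub.
exact/set_refusals_after/sub.
Qed.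

(** * Soundness: the loop invariant and closed antichains *)

Definition safe v A x : Prop :=
  check v x <> Reject /\
  (check v x = Proceed -> forall a t, trans x.2 a t ->
     post x.1 a != set0 /\ covered (post x.1 a, t) A).

Definition closed_antichain v A : Prop :=
  covered (init_pair L1 L2) A /\ forall y, y \in A -> safe v A y.

Lemma for_loop_inv spec ts w A w' A' :
  for_loop spec ts w A = Running w' A' ->
  [/\ forall z, covered z A -> covered z A',
      forall y, y \in A' -> y \in A \/ y \in w',
      {subset w <= w'} &
      forall a t, (a, t) \in ts ->
        post spec a != set0 /\ covered (post spec a, t) A'].
Proof.
elim: ts w A => [|[a t] ts IH] w A /=; first by case=> -> ->; split=> // y; left.
case: eqP => // /eqP ne0; case: ifP => [cov|_] /IH[covA' memA' sub_w succ].
  split=> // b u; rewrite inE => /predU1P[[-> ->]|]; last exact: succ.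
  by split=> //; exact: covA'.
split.
- by move=> z zA; exact/covA'/covered_add.
- move=> y /memA'[|]; last by right.
  rewrite inE => /predU1P[->|/andP[]]; last by left.
  by right; apply: sub_w; rewrite mem_head.
- by move=> y yw; apply: sub_w; rewrite inE yw orbT.
- move=> b u; rewrite inE => /predU1P[[-> ->]|]; last exact: succ.
  by split=> //; exact/covA'/covered_add_self.
Qed.

Lemma for_loop_not_true spec ts w A :
  for_loop spec ts w A <> Returned _ _ true.
Proof. by elim: ts w A => [|[a t] ts IH] w A //=; do 2 case: ifP => //. Qed.

Variable sched : nat -> state L2 -> seq (option Act * state L2).
Hypothesis sched_ok : is_schedule sched.

Lemma mem_sched n s a t : ((a, t) \in sched n s) = trans s a t.
Proof. by rewrite (perm_mem (sched_ok n s)) mem_enum inE. Qed.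

(** Members of the antichain are pending on the stack or already safe. The converse is not
    invariant: a pair may leave the antichain while still on the stack. *)
Definition loop_inv v (c : config L1 L2) : Prop :=
  match c with
  | Running w A =>
      covered (init_pair L1 L2) A /\ forall y, y \in A -> y \in w \/ safe v A y
  | Returned true => exists A, closed_antichain v A
  | Returned false => True
  end.

Lemma run_inv v n : loop_inv v (run L1 v sched n).
Proof.
elim: n => [|n] /=.
  split; first by apply: covered_mem; rewrite inE.
  by move=> y /set1P->; left; rewrite inE.
case: (run L1 v sched n) => [[|x w] A|[]] //= [covA memA].
  by exists A; split=> // y /memA[].
case chk: (check v x) => //=.
  split=> // y /memA[|]; last by right.
  rewrite inE => /predU1P[->|]; last by left.
  by right; split; rewrite chk.
case loop: (for_loop _ _ _ _) => [w' A'|[]] //; last by case: (for_loop_not_true loop).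
have [covA' memA' sub_w succ] := for_loop_inv loop.
split=> [|y /memA'[/memA[]|]]; [exact: covA' | | | by left].
- rewrite inE => /predU1P[->|/sub_w]; last by left.
  right; split=> [|_ a t]; first by rewrite chk.
  by rewrite -(mem_sched n) => /succ.
(* Safety survives changes of the antichain because coverage is never lost. *)
- case=> ok succ_y; right; split=> // prc a t yt.
  by have [? /covA'] := succ_y prc a t yt.
Qed.

Lemma returns_true_closed v :
  returns L1 v sched true -> exists A, closed_antichain v A.
Proof. by case=> n eq_run; have := run_inv v n; rewrite eq_run. Qed.

Lemma check_Fdr_Skip x : check Fdr x = Skip <-> set_diverges x.1.
Proof. by rewrite /=; case: asboolP => //; case: ifP => //; case: ifP. Qed.

Lemma check_Skip v x : check v x = Skip -> v = Fdr /\ set_diverges x.1.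
Proof.
by case: v => [||/check_Fdr_Skip] //=; case: ifP.
Qed.

(** Induction along the path keeps a member of [A] below the current pair; [post] is monotone, so
    its covered successors lie below the next pair. If that member is skipped, its specification
    part diverges, and hence so does L1 on the trace. *)
Lemma closed_antichain_path v A rho t :
  closed_antichain v A -> path_to (init L2) rho t ->
  (v = Fdr /\ divergences L1 rho) \/
  [/\ check v (after L1 rho, t) = Proceed & weaktraces L1 rho].
Proof.
move=> [cov0 safeA].
suff main : path_to (init L2) rho t -> (v = Fdr /\ divergences L1 rho) \/
    covered (after L1 rho, t) A /\ weaktraces L1 rho.
  move=> /main[|[/exists_inP[y /safeA[ok _] yx] tr]]; first by left.
  have [dv|nd] := pselect (v = Fdr /\ divergences L1 rho); first by left.
  right; split=> //; case/andP: (yx) => /eqP /= yt sub.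
  case: v ok nd {safeA main} => //= ok nd.
    by move: ok; case: ifP => // /(refusals_ok_le yx) ->.
  (* Without divergence of L1 on [rho], neither the pair nor the smaller [y] is skipped, so the
     refusal check passes from [y] to the pair. *)
  have ndx : ~ set_diverges (after L1 rho) by move=> /after_diverges dr; apply: nd.
  have ndy : ~ set_diverges y.1 by move/(set_diverges_sub sub).
  move: ok; rewrite (asboolF ndx) (asboolF ndy) yt; case: ifP => // _.
  by case: ifP => // /(refusals_ok_le yx) ->.
elim=> [|r u s _ IH us|r u a s _ IH us].
- by right; split=> //; exists (init L1); exact: weak_refl.
- case: IH => [|[/exists_inP[y yA yx] tr]]; first by left.
  have [ok succ] := safeA y yA; case/andP: (yx) => /eqP /= yu sub.
  case chk: (check v y) => //.
    have [-> dy] := check_Skip chk; left; split=> //.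
    exact/after_diverges/(set_diverges_sub sub).
  have [|_ cov] := succ chk None s; first by rewrite yu.
  right; split=> //; apply: covered_le cov _.
  by rewrite /pair_le eqxx.
- case: IH => [[-> dv]|[/exists_inP[y yA yx] tr]].
    by left; split=> //; apply/divergences_rcons; left.
  have [ok succ] := safeA y yA; case/andP: (yx) => /eqP /= yu sub.
  case chk: (check v y) => //.
    have [-> dy] := check_Skip chk; left; split=> //.
    apply/divergences_rcons; left.
    exact/after_diverges/(set_diverges_sub sub).
  have [|ne cov] := succ chk (Some a) s; first by rewrite yu.
  have subp := post_sub (Some a) sub; rewrite post_after in subp.
  right; split; first by apply: covered_le cov _; rewrite /pair_le eqxx.
  apply/after_neq0; case/set0Pn: ne => z /(subsetP subp) zin.
  by apply/set0Pn; exists z.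
Qed.

(** * Completeness: visited pairs and termination *)

Definition visited v x : Prop :=
  exists rho, [/\ x.1 = after L1 rho, weak (init L2) rho x.2 &
    v = Fdr -> divergences L1 rho -> set_diverges x.1].

Definition never_fails v : Prop :=
  forall x, visited v x -> check v x <> Reject /\
    (check v x = Proceed -> forall a t, trans x.2 a t -> post x.1 a != set0).

Lemma visited_init v : visited v (init_pair L1 L2).
Proof.
exists [::]; split=> //; first exact: weak_refl.
move=> _ [[|b r] [sigma [eq_nil [t [rt dt]]]]] //.
by exists t => //; apply/in_after.
Qed.

(** For [Fdr], a divergence of L1 on the old trace would make the specification part of [x] diverge,
    so [x] would be skipped. Hence a divergence on the extended trace must occur at its very end. *)
Lemma visited_succ v x a t :
  visited v x -> check v x = Proceed -> trans x.2 a t ->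
  visited v (post x.1 a, t).
Proof.
case: x => U s [rho /= [-> rs dv]] chk; case: a => [a|] st; last first.
  exists rho; split=> //.
  by rewrite -[rho]cats0; exact: weak_cat rs (weak_tau st).
exists (rcons rho a); split=> /=.
- exact: post_after.
- by rewrite -cats1; exact: weak_cat rs (weak_act st).
- move=> eq_v /divergences_rcons[/(dv eq_v) du|]; last by rewrite -post_after.
  by subst v; move/(check_Fdr_Skip (_, s)): du; rewrite chk.
Qed.

Lemma for_loop_decr (P : pair -> Prop) spec ts w A :
  (forall a t, (a, t) \in ts -> post spec a != set0 /\ P (post spec a, t)) ->
  (forall y, y \in w -> P y) ->
  exists w' A', [/\ for_loop spec ts w A = Running w' A',
    forall y, y \in w' -> P y &
    size w' + (uncovered A').*2 <= size w + (uncovered A).*2].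
Proof.
elim: ts w A => [|[a t] ts IH] w A tsP wP /=; first by exists w, A.
have [/negPf-> Pt] := tsP a t (mem_head _ _).
have tsP' b u : (b, u) \in ts -> post spec b != set0 /\ P (post spec b, u).
  by move=> but; apply: tsP; rewrite inE but orbT.
case: ifPn => [_|ncov]; first exact: IH.
have [|w' [A' [-> w'P le]]] :=
    IH ((post spec a, t) :: w) (antichain_add A (post spec a, t)) tsP'.
  by move=> y; rewrite inE => /predU1P[->|/wP].
exists w', A'; split=> //; apply: leq_trans le _.
(* A push adds one to the stack and removes at least two from the doubled count; the spare unit is
   dropped here. *)
rewrite /= addSnnS leq_add2l; apply: ltnW.
by rewrite -doubleS leq_double uncovered_add.
Qed.

(** Each iteration pops one pair, which pays for the increment of [n]. The final successor in the
    bound is the initial stack of size one. *)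
Lemma run_progress v n : never_fails v ->
  run L1 v sched n = Returned _ _ true \/
  exists w A, [/\ run L1 v sched n = Running w A,
    forall y, y \in w -> visited v y &
    n + (size w + (uncovered A).*2) <=
      (uncovered [set init_pair L1 L2]).*2.+1].
Proof.
move=> ok; elim: n => [|n IH] /=; last case: IH => [->|[w [A [-> wP le]]]].
- right; exists [:: init_pair L1 L2], [set init_pair L1 L2]; split=> //.
  by move=> y; rewrite inE => /eqP->; exact: visited_init.
- by left.
case: w wP le => [|x w] wP le; first by left.
rewrite /= addSn addnS in le; right=> /=; have visx := wP x (mem_head _ _).
have wP' y : y \in w -> visited v y by move=> yw; apply: wP; rewrite inE yw orbT.
have [nrej ne] := ok x visx.
case chk: (check v x) => //=.
  by exists w, A.
have [|w' [A' [-> w'P le']]] :=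
    @for_loop_decr (visited v) x.1 (sched n x.2) w A _ wP'.
  move=> a t; rewrite mem_sched => xt.
  by split; [exact: ne chk _ _ xt | exact: visited_succ].
exists w', A'; split=> //; apply: leq_trans le.
by rewrite addSn ltnS leq_add2l.
Qed.

Lemma never_fails_returns v : never_fails v -> returns L1 v sched true.
Proof.
(* One iteration more than the bound of [run_progress] allows for a running configuration. *)
move=> ok; exists (uncovered [set init_pair L1 L2]).*2.+2.
have [//|[w [A [_ _]]]] := run_progress (uncovered [set init_pair L1 L2]).*2.+2 ok.
by move/(leq_trans (leq_addr _ _)); rewrite ltnn.
Qed.

(** Trace inclusion is assumed only for [rho] and its one-letter extensions, since under [Fdr] it
    can fail for traces that extend a divergence of L1. *)
Lemma post_neq0 rho a t s : weak (init L2) rho s -> trans s a t ->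
  (forall rho', weaktraces L2 rho' ->
     rho' = rho \/ (exists b, rho' = rcons rho b) -> weaktraces L1 rho') ->
  post (after L1 rho) a != set0.
Proof.
case: a => [a|] rs st sub.
  rewrite post_after; apply/after_neq0/sub; last by right; exists a.
  by exists t; rewrite -cats1; exact: weak_cat rs (weak_act st).
by apply/after_neq0/sub; [exists s | left].
Qed.

(** * The three equivalences *)

Lemma Tr_correct : returns L1 Tr sched true <-> refines_tr L1 L2.
Proof.
split=> [/returns_true_closed[A cl] rho [t /weakP rt]|ref].
  by case: (closed_antichain_path cl rt) => [[]|[]].
apply: never_fails_returns => -[U s] [rho /= [-> rs _]]; split=> // _ a t st.
by apply: (post_neq0 rs st) => r /ref.
Qed.

Lemma Sfr_correct : returns L1 Sfr sched true <-> refines_sfr L1 L2.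
Proof.
split=> [/returns_true_closed[A cl]|[reff reft]].
  split=> [[rho X] [t [/= /weakP rt st tX]]|rho [t /weakP rt]];
    case: (closed_antichain_path cl rt) => [[]|[]] //=.
  by case: ifP => // ok _ _; exact: failures_refusals_ok ok.
apply: never_fails_returns => -[U s] [rho /= [-> rs _]]; split.
  by rewrite refusals_ok_after // => X /reff.
by move=> _ a t st; apply: (post_neq0 rs st) => r /reft.
Qed.

Lemma Fdr_correct : returns L1 Fdr sched true <-> refines_fdr L1 L2.
Proof.
split=> [/returns_true_closed[A cl]|[reff refd]].
  have sub_div : forall rho, divergences L2 rho -> divergences L1 rho.
    move=> _ [rho [sigma [-> [t [/weakP rt dt]]]]].
    (* The diverging prefix suffices, as divergences are closed under extension. Otherwise the check
       would have to proceed on a pair whose state [t] diverges. *)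
    have : divergences L1 rho.
      case: (closed_antichain_path cl rt) => [[]|[]] //=.
      by case: ifP => // _; rewrite asboolT.
    by case=> r [sg [-> r_div]]; exists r, (sg ++ sigma); rewrite catA.
  split=> // -[rho X] [|/sub_div]; last by right.
  move=> [t [/= /weakP rt st tX]].
  case: (closed_antichain_path cl rt) => [[_ ?]|[]] /=; first by right.
  case: ifP => // _; case: ifP => // _; case: ifP => // ok _ _.
  by left; exact: failures_refusals_ok ok.
apply: never_fails_returns => -[U s] [rho /= [-> rs /(_ erefl) dv]].
case: asboolP => // nd.
have ndr : ~ divergences L1 rho by move=> /dv.
have nds : ~ diverges s.
  move=> ds; apply/ndr/refd.
  by exists rho, [::]; rewrite cats0; split=> //; exists s.
rewrite asboolF // refusals_ok_after //; last first.
  by move=> X fX; case: (reff (rho, X)) => //; left.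
split=> // _ a t st; apply: (post_neq0 rs st) => r.
(* A stable failure of L1 on [r] yields the trace at once. A divergence cannot come from [rho], so
   L1 diverges after exactly [rcons rho b], which is then a trace. *)
move=> /weaktraces_failures_bot/reff[[u [ru _ _]] _|dr]; first by exists u.
case=> [eq_r|[b eq_r]]; first by rewrite eq_r in dr.
move: dr; rewrite eq_r => /divergences_rcons[//|[u /in_after ru _]].
by exists u.
Qed.

End Correctness.

Theorem theorem5p2 (Act : finType) (L1 L2 : lts Act)
    (sched : nat -> state L2 -> seq (option Act * state L2))
    (sched_ok : is_schedule sched) :
  [/\ returns L1 Tr sched true <-> refines_tr L1 L2,
      returns L1 Sfr sched true <-> refines_sfr L1 L2 &
      returns L1 Fdr sched true <-> refines_fdr L1 L2].
Proof.
split; [exact: Tr_correct | exact: Sfr_correct | exact: Fdr_correct].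
Qed.
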